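(* Let $q$ be a power of a prime $p$ and let $e,k$ be nontrivial divisors of $q-1$ such that $q=ek+1$. Let $a\in\{1,\dots,e-1\}$. If $$p>\left(\frac{4k}{\varphi(k)}\right)^{\frac{\varphi(k)}{2\operatorname{ord}_k(p)}},$$ then the cyclotomic number $(0,a)$ of order $e$ over $\mathbb{F}_q$ satisfies $$(0,a)\le\begin{cases}3&\text{if } 2\in C_a,\\ 2&\text{if } 2\notin C_a.\end{cases}$$
   Context: A nontrivial divisor of $q-1$ is a divisor different from $1$ and $q-1$. $\operatorname{ord}_k(p)$ is the multiplicative order of $p$ modulo $k$ and $\varphi$ is Euler's totient function. Fix a primitive element $g$ of the finite field $\mathbb{F}_q$. For $a\in\mathbb{Z}$ let $C_a=\{g^a,g^{a+e},\dots,g^{a+(k-1)e}\}$, so that $C_a=C_{a+e}$. The cyclotomic number $(a,b)$ of order $e$ is the number of solutions of $1+x=y$ with $x\in C_a$, $y\in C_b$; equivalently, the number of pairs of integers $(r,s)$ with $0\le r,s\le k-1$ and $1+g^{a+re}=g^{b+se}$. In ''$2\in C_a$'', $2$ denotes the element $1+1$ of $\mathbb{F}_q$. *)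

(* Defs.v *)
From HB Require Import structures.
From mathcomp Require Import all_boot all_order all_algebra all_fingroup all_field.
From mathcomp Require Import reals exp.

Set Implicit Arguments.
Unset Strict Implicit.
Unset Printing Implicit Defensive.

Import Order.TTheory GRing.Theory Num.Theory.

Local Open Scope ring_scope.

(* The order of p in the unit group of Z/k. Meaningful only for 1 < k ('Z_0 and
   'Z_1 are Z/2) and p coprime to k (otherwise insubd defaults to 1). *)
Definition ord_mod (k p : nat) : nat :=
  #[insubd (1%g : {unit 'Z_k}) (p%:R : 'Z_k)]%g.

Definition nontrivial_divisor (d m : nat) : bool :=
  [&& (d %| m)%N, d != 1%N & d != m].

Section Cyclotomy.

Variables (F : finFieldType) (g : F) (e k : nat).

Definition cyc_class (a : int) : {set F} :=
  [set g ^ (a + (i * e)%N%:Z) | i : 'I_k].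

Definition cyc_number (a b : int) : nat :=
  #|[set xy : F * F | [&& xy.1 \in cyc_class a, xy.2 \in cyc_class b
                        & 1 + xy.1 == xy.2]]|.

End Cyclotomy.

(* Main.v *)
Require Import Defs.
From HB Require Import structures.
From mathcomp Require Import all_boot all_order all_algebra all_fingroup all_field.
From mathcomp Require Import ring cyclic.
From mathcomp Require Import reals exp.

Set Implicit Arguments.
Unset Strict Implicit.
Unset Printing Implicit Defensive.

Import Order.TTheory GRing.Theory Num.Theory.

Local Open Scope ring_scope.

(** Write [w] for the primitive [k]-th root of unity [g ^+ e], so that
    [cyc_class g e k 0] consists of the powers of [w].  If [x] and [x'] are two
    such powers with [1 + x] and [1 + x'] in the same cyclotomic class, then
    [1 + x = y * (1 + x')] for a third power [y]: the four-term integer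
    polynomial [f = 1 + X^i - X^j - X^(j + i')] vanishes at [w].  The hypothesis
    on [p] forces this relation to hold already among complex roots of unity.

    Let [z] be a complex primitive [k]-th root of unity and [N] the norm of
    [f(z)], the product of the values of [f] at all primitive [k]-th roots.

    - [N] is divisible by [p ^ d], [d] being the order of [p] mod [k]: it is the
      determinant of multiplication by [f] on [Z[X] / Phi_k], and modulo [p] the
      matrix kills [d] independent column vectors, one for each of the common
      roots [w ^+ (p ^ t)], [t < d], of [f] and [Phi_k].  The Smith normal form
      turns a rank defect of [d] modulo [p] into divisibility by [p ^ d]
      ([dvdn_det_of_kernel_mod_p]).
    - [N] is small: by Parseval ([parseval_prim_root]) the squares of the moduli
      of [f] over all [k]-th roots of unity add up to [k] times the sum of the
      squared coefficients, which is at most [4 * k] as long as [x] and [x']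
      differ from [1]; by the inequality of the arithmetic and geometric means
      [N ^ 2 <= (4 * k / totient k) ^ totient k], which is less than
      [p ^ (2 * d)].

    Hence [N = 0], and the relation lifts to [algC] ([root_lift_of_small_norm]).
    There, taking moduli in [1 + x = y * (1 + x')] gives
    [x + 1 / x = x' + 1 / x'], so that [x'] is [x] or [1 / x]
    ([unit_norm_ratio]).  This conclusion descends to the finite field: apart
    from [x = 1], which is a solution only if [2] lies in the class, there are
    at most two solutions. *)

(** * Divisibility of determinants by powers of a prime *)

Lemma pchar_intr_eq0 (F : fieldType) (p : nat) (s : int) :
  p \in [pchar F] -> (s%:~R == 0 :> F) = (p %| `|s|)%N.
Proof.
move=> charFp; rewrite (dvdn_pcharf charFp) {1}[s]intEsign rmorphM rmorph_sign.
by rewrite mulf_eq0 signr_eq0.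
Qed.

Lemma mxrank_le_nonzero_rows (F : fieldType) (m n : nat) (A : 'M[F]_(m, n))
    (T : {set 'I_m}) :
  (forall i, i \notin T -> row i A = 0) -> (\rank A <= #|T|)%N.
Proof.
move=> A0; pose B := rowsub (fun i : 'I_#|T| => enum_val i) A.
apply: leq_trans (rank_leq_row B); apply: mxrankS; apply/row_subP => i.
have [iT|/A0->] := boolP (i \in T); last exact: sub0mx.
have -> : row i A = row (enum_rank_in iT i) B.
  by rewrite row_rowsub enum_rankK_in.
exact: row_sub.
Qed.

(** In the Smith form [M = L D Q], the columns of [Q W] are killed by [D] modulo
    [p], so the rows of the rank [d] matrix [Q W] vanish except where [p]
    divides the diagonal entry of [D]; there are thus at least [d] such
    entries. *)
Lemma dvdn_det_of_kernel_mod_p (F : fieldType) (p n d : nat)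
    (M : 'M[int]_n) (W : 'M[F]_(n, d)) :
  p \in [pchar F] -> \rank W = d -> map_mx intr M *m W = 0 ->
  (p ^ d %| `|\det M|)%N.
Proof.
move=> charFp rW; have [L uL [Q uQ [s _ defM]]] := int_Smith_normal_form M.
have unitF (A : 'M[int]_n) : A \in unitmx -> map_mx intr A \in (@unitmx F n).
  by rewrite !unitmxE det_map_mx => /(rmorph_unit (intr : {rmorphism int -> F})).
set D := \matrix_(i, j) _ in defM.
have defD : D = diag_mx (\row_i s`_i).
  by apply/matrixP => i j; rewrite !mxE -val_eqE /=.
rewrite defM !map_mxM /= -!mulmxA => /(congr1 (mulmx (invmx (map_mx intr L)))).
rewrite mulKmx ?unitF // mulmx0; set W' := map_mx _ Q *m W => DW0.
have rW' : \rank W' = d.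
  by rewrite (eqmxMfull W) ?row_full_unit ?unitF.
pose T := [set i : 'I_n | (p %| `|(s`_i)%R|)%N].
have leT : (d <= #|T|)%N.
  rewrite -rW'; apply: mxrank_le_nonzero_rows => i.
  rewrite inE -(pchar_intr_eq0 _ charFp) => si0; apply/rowP => j.
  move/matrixP/(_ i j): DW0; rewrite defD map_diag_mx mul_diag_mx !mxE => /eqP.
  by rewrite mulf_eq0 (negPf si0) => /eqP.
apply: dvdn_trans (dvdn_exp2l p leT) _.
rewrite !det_mulmx defD det_diag !abszM mulnCA; apply: dvdn_mulr.
rewrite (eq_bigr (fun i : 'I_n => s`_i)) => [|i _]; last by rewrite !mxE.
rewrite (bigID (mem T)) /= abszM dvdn_mulr //.
rewrite -prod_nat_const (big_morph absz abszM absz1).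
by apply: (big_ind2 dvdn) => // [????|i]; [apply: dvdn_mul | rewrite inE].
Qed.

Lemma rank_power_matrix (F : fieldType) (n d : nat) (w : 'I_d -> F) :
  injective w -> (d <= n)%N -> \rank (\matrix_(i < n, t < d) w t ^+ i) = d.
Proof.
move=> w_inj le_dn; set W := \matrix_(i, t) _.
apply/eqP; rewrite eqn_leq rank_leq_col /=.
pose V := rowsub (widen_ord le_dn) W.
have defV : V = Vandermonde d (\row_t w t) by apply/matrixP => i t; rewrite !mxE.
have: V \in unitmx.
  rewrite defV unitmxE det_Vandermonde unitfE.
  apply/prodf_neq0 => i _; apply/prodf_neq0 => j ltij; rewrite !mxE subr_eq0.
  by apply: contraTneq ltij => /w_inj->; rewrite ltnn.
rewrite -row_free_unit => /eqP {1}<-; apply: mxrankS; exact: rowsub_sub.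
Qed.

(** * The norm of an algebraic integer as a determinant *)

(** The matrix of multiplication by [f] on [Z[X] / (P)], acting on row vectors in
    the basis of the powers of [X]; [n] is meant to be the degree of [P]. *)
Definition mulmod_mx (P f : {poly int}) (n : nat) : 'M[int]_n :=
  \matrix_(i, j) (Pdiv.Ring.rmodp ('X^i * f) P)`_j.

(** Evaluation at a root of [P] is a well-defined ring morphism on
    [Z[X] / (P)], so the vector of the powers of this root is an eigenvector. *)
Lemma mulmod_mx_eigen (P f : {poly int}) (K : comNzRingType) n m
    (x : 'I_m -> K) :
  P \is monic -> size P = n.+1 -> (forall t, (map_poly intr P).[x t] = 0) ->
  map_mx intr (mulmod_mx P f n) *m \matrix_(j < n, t < m) x t ^+ j =
  \matrix_(i, t) ((map_poly intr f).[x t] * x t ^+ i).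
Proof.
move=> monP szP Px0; apply/matrixP => i t; rewrite !mxE.
set r := Pdiv.Ring.rmodp ('X^i * f) P.
have szr : (size r <= n)%N.
  by rewrite -ltnS -szP Pdiv.Ring.ltn_rmodpN0 // monic_neq0.
transitivity (map_poly intr r).[x t].
  rewrite (@horner_coef_wide _ n) ?(leq_trans (size_poly _ _)) //.
  by apply: eq_bigr => j _; rewrite !mxE coef_map.
have := congr1 (fun q => (map_poly intr q).[x t])
  (Pdiv.RingMonic.rdivp_eq monP ('X^i * f)).
rewrite rmorphD !rmorphM /= map_polyXn hornerD !hornerM Px0 mulr0 add0r hornerXn.
by rewrite mulrC => <-.
Qed.

(** The Vandermonde matrix of the roots diagonalizes the multiplication by [f],
    with the values of [f] at these roots as eigenvalues. *)
Lemma det_mulmod_mx (P f : {poly int}) (K : fieldType) n (z : 'I_n -> K) :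
  P \is monic -> size P = n.+1 -> injective z ->
  (forall t, (map_poly intr P).[z t] = 0) ->
  (\det (mulmod_mx P f n))%:~R = \prod_t (map_poly intr f).[z t].
Proof.
move=> monP szP z_inj Pz0; set V := \matrix_(j < n, t < n) z t ^+ j.
have uV : V \in unitmx by rewrite -row_free_unit /row_free rank_power_matrix.
have /(congr1 (fun A => \det A)) := mulmod_mx_eigen f monP szP Pz0.
rewrite -/V (_ : \matrix_(i, t) _ = V *m diag_mx (\row_t (map_poly intr f).[z t])).
  rewrite !det_mulmx det_diag det_map_mx mulrC => /mulrI->; last by rewrite -unitmxE.
  by apply: eq_bigr => t _; rewrite mxE.
by apply/matrixP => i t; rewrite mul_mx_diag !mxE mulrC.
Qed.

Lemma dvdn_det_mulmod_mx (P f : {poly int}) (F : fieldType) p n d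
    (w : 'I_d -> F) :
  p \in [pchar F] -> P \is monic -> size P = n.+1 -> injective w -> (d <= n)%N ->
  (forall t, (map_poly intr P).[w t] = 0) ->
  (forall t, (map_poly intr f).[w t] = 0) ->
  (p ^ d %| `|\det (mulmod_mx P f n)|)%N.
Proof.
move=> charFp monP szP w_inj le_dn Pw0 fw0.
apply: (dvdn_det_of_kernel_mod_p charFp (rank_power_matrix w_inj le_dn)).
rewrite mulmod_mx_eigen //; apply/matrixP => i t.
by rewrite !mxE fw0 mul0r.
Qed.

(** * Roots of cyclotomic polynomials in characteristic p *)

Lemma horner_map_intr_pX (F : comNzRingType) p (f : {poly int}) (x : F) t :
  p \in [pchar F] ->
  (map_poly intr f).[x ^+ (p ^ t)] = (map_poly intr f).[x] ^+ (p ^ t).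
Proof.
move=> charFp; elim: t => [|t IHt]; first by rewrite expn0 !expr1.
rewrite expnSr !exprM -IHt -!(pFrobenius_autE charFp) -horner_map /=.
rewrite -map_poly_comp; congr (_.[_]); apply: eq_map_poly => c /=.
by rewrite rmorph_int.
Qed.

(** As [w] is a root of [X^k - 1], it is a root of [Phi_d] for some [d] dividing
    [k], hence of [X^d - 1]; its order being [k], this forces [d = k]. *)
Lemma root_map_Cyclotomic (F : fieldType) k (w : F) :
  k.-primitive_root w -> (map_poly intr 'Phi_k).[w] = 0.
Proof.
move=> w_prim; have k_gt0 := prim_order_gt0 w_prim.
have XnE (R : nzRingType) m : map_poly intr ('X^m - 1) = 'X^m - 1 :> {poly R}.
  by rewrite rmorphB /= rmorph1 map_polyXn.
have := congr1 (fun q => (map_poly intr q).[w]) (prod_Cyclotomic k_gt0).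
rewrite XnE hornerD hornerN hornerXn hornerC (prim_expr_order w_prim) subrr.
rewrite rmorph_prod horner_prod /= => /eqP; rewrite prodf_seq_eq0 => /hasP[d].
rewrite -dvdn_divisors // => dk /= /eqP Pd0.
suff wd1 : w ^+ d = 1.
  have kd : (k %| d)%N by rewrite (prim_order_dvd w_prim) wd1.
  by rewrite -[k in 'Phi_k](@gcdn_idPl k d kd) (gcdn_idPr dk).
have d_gt0 := dvdn_gt0 k_gt0 dk.
have := congr1 (fun q => (map_poly intr q).[w]) (prod_Cyclotomic d_gt0).
rewrite XnE (big_rem d) ?divisors_id //= rmorphM hornerM Pd0 mul0r.
by rewrite hornerD hornerN hornerXn hornerC => /esym/eqP; rewrite subr_eq0 => /eqP.
Qed.

Lemma ord_mod_gt0 (k p : nat) : (0 < ord_mod k p)%N.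
Proof. exact: order_gt0. Qed.

Lemma ord_mod_le_totient (k p : nat) :
  (0 < k)%N -> (ord_mod k p <= totient k)%N.
Proof.
move=> k_gt0; rewrite -(card_units_Zp k_gt0) /ord_mod orderE.
by apply/subset_leq_card/subsetP => v _; rewrite inE.
Qed.

Lemma expn_ord_mod_inj (k p s t : nat) :
  (1 < k)%N -> coprime k p -> (s < ord_mod k p)%N -> (t < ord_mod k p)%N ->
  p ^ s = p ^ t %[mod k] -> s = t.
Proof.
move=> k_gt1 co_kp; rewrite /ord_mod; set u := insubd _ _ => lt_s lt_t eq_st.
have val_u : val u = p%:R by rewrite val_insubd unitZpE ?co_kp.
have: (u ^+ s == u ^+ t)%g.
  rewrite -(inj_eq val_inj) !FinRing.val_unitX val_u -!natrX.
  by rewrite -(Zp_nat_mod k_gt1) eq_st (Zp_nat_mod k_gt1).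
by rewrite eq_expg_mod_order !modn_small // => /eqP.
Qed.

(** * The size of the norm, and lifting of roots *)

(** Expanding the squares gives a double sum of [z ^+ (u * (m - l))]; summing
    over [u] first, only the diagonal terms [m = l] survive. *)
Lemma parseval_prim_root (k : nat) (z : algC) (f : {poly int}) :
  k.-primitive_root z -> (size f <= k)%N ->
  \sum_(u < k) `|(map_poly intr f).[z ^+ u]| ^+ 2 =
  (k%:Z * \sum_(m < k) f`_m ^+ 2)%:~R.
Proof.
move=> z_prim szf; have k_gt0 := prim_order_gt0 z_prim.
have zk := prim_expr_order z_prim.
have zz m : z ^+ m * (z ^+ m)^* = 1.
  rewrite -normCK normrX (_ : `|z| = 1) ?expr1n //.
  by apply/eqP; rewrite -(@pexpr_eq1 _ _ k) // -normrX zk normr1.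
have orth (m l : 'I_k) :
    \sum_(u < k) (z ^+ u) ^+ m * ((z ^+ u) ^+ l)^* = (k * (m == l))%:R.
  (* A geometric sum with ratio r, and r ^+ k = 1. *)
  pose r := z ^+ m * (z ^+ l)^*.
  transitivity (\sum_(u < k) r ^+ u).
    apply: eq_bigr => u _; rewrite exprMn -rmorphXn /= -!exprM.
    by rewrite ![(u * _)%N]mulnC.
  have [eq_ml|neq_ml] := eqVneq m l.
    rewrite /r eq_ml; under eq_bigr do rewrite zz expr1n.
    by rewrite sumr_const card_ord muln1.
  rewrite muln0; apply/eqP; have/eqP := subrX1 r k.
  have -> : r ^+ k = 1.
    by rewrite exprMn -rmorphXn /= -!exprM ![(_ * k)%N]mulnC !exprM zk !expr1n
      rmorph1 mulr1.
  rewrite subrr eq_sym mulf_eq0 => /orP[|//]; rewrite subr_eq0 => /eqP r1.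
  have /eqP : z ^+ m = z ^+ l.
    by rewrite -[RHS]mul1r -r1 /r -mulrA [_^* * _]mulrC zz mulr1.
  rewrite (eq_prim_root_expr z_prim) !modn_small // => /eqP/val_inj eq_ml.
  by rewrite eq_ml eqxx in neq_ml.
have evalE x : (map_poly intr f).[x] = \sum_(m < k) (f`_m)%:~R * x ^+ m :> algC.
  rewrite (@horner_coef_wide _ k) ?(leq_trans (size_poly _ _)) //.
  by apply: eq_bigr => m _; rewrite coef_map.
transitivity (\sum_(m < k) \sum_(l < k) \sum_(u < k)
  (f`_m * f`_l)%:~R * ((z ^+ u) ^+ m * ((z ^+ u) ^+ l)^*) : algC).
  under [RHS]eq_bigr do rewrite exchange_big /=.
  rewrite exchange_big /=; apply: eq_bigr => u _.
  rewrite normCK evalE rmorph_sum mulr_suml; apply: eq_bigr => m _.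
  rewrite mulr_sumr; apply: eq_bigr => l _.
  by rewrite rmorphM rmorph_int intrM mulrACA.
rewrite intrM rmorph_sum mulr_sumr; apply: eq_bigr => m _.
rewrite (bigD1 m) //= -mulr_sumr orth eqxx muln1 big1 ?addr0 => [|l neq_lm].
  by rewrite mulrC expr2.
by rewrite -mulr_sumr orth eq_sym (negPf neq_lm) muln0 mulr0.
Qed.

(** The norm [N] of [f] at a complex primitive root is an integer divisible by
    [p ^ ord_mod k p], whereas the bound on the coefficients gives
    [N ^ 2 <= (k * s / totient k) ^ totient k]; the last numerical hypothesis,
    with denominators cleared, leaves only [N = 0]. *)
Lemma root_lift_of_small_norm (F : fieldType) (p k s : nat) (w : F)
    (f : {poly int}) :
  p \in [pchar F] -> (1 < k)%N -> coprime k p -> k.-primitive_root w ->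
  (size f <= k)%N -> \sum_(m < k) f`_m ^+ 2 <= s%:Z ->
  ((k * s) ^ totient k < p ^ (2 * ord_mod k p) * totient k ^ totient k)%N ->
  (map_poly intr f).[w] = 0 ->
  exists2 z : algC, k.-primitive_root z & (map_poly intr f).[z] = 0.
Proof.
move=> charFp k_gt1 co_kp w_prim szf f_small small fw0.
have k_gt0 := ltnW k_gt1; have [z z_prim] := C_prim_root_exists k_gt0.
pose A := [pred u : 'I_k | coprime k u].
have cardA : #|A| = totient k.
  rewrite totient_count_coprime big_mkord -sum1_card big_mkcond.
  by apply: eq_bigr => u _; rewrite inE; case: coprime.
pose zA (i : 'I_#|A|) := z ^+ (enum_val i : 'I_k).
have zA_prim i : k.-primitive_root (zA i).
  have:= enum_valP i; rewrite inE coprime_sym => co_ik.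
  by rewrite (prim_root_exp_coprime _ z_prim).
have [i /eqP fz0|no_root] := pickP (fun i => (map_poly intr f).[zA i] == 0).
  by exists (zA i).
have zA_inj : injective zA.
  move=> i j /eqP; rewrite (eq_prim_root_expr z_prim) !modn_small // => /eqP.
  by move/val_inj/enum_val_inj.
(* The conjugates of w under Frobenius: common roots of f and 'Phi_k. *)
pose wd (t : 'I_(ord_mod k p)) := w ^+ (p ^ t).
have wd_prim t : k.-primitive_root (wd t).
  by rewrite (prim_root_exp_coprime _ w_prim) coprime_sym coprimeXr.
have wd_inj : injective wd.
  move=> t t' /eqP; rewrite (eq_prim_root_expr w_prim) => /eqP.
  by move/(expn_ord_mod_inj k_gt1 co_kp (ltn_ord t) (ltn_ord t'))/val_inj.
have szP : size 'Phi_k = #|A|.+1 by rewrite size_Cyclotomic cardA.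
have monP := Cyclotomic_monic k.
have le_d : (ord_mod k p <= #|A|)%N by rewrite cardA ord_mod_le_totient.
have normE := det_mulmod_mx f monP szP zA_inj
  (fun i => root_map_Cyclotomic (zA_prim i)).
have pdN : (p ^ ord_mod k p %| `|\det (mulmod_mx 'Phi_k f #|A|)|)%N.
  apply: (dvdn_det_mulmod_mx charFp monP szP wd_inj le_d) => t.
    exact: root_map_Cyclotomic.
  have p_gt0 := prime_gt0 (pcharf_prime charFp).
  by rewrite horner_map_intr_pX // fw0 expr0n expn_eq0 eqn0Ngt p_gt0.
set N := \det _ in normE pdN.
have N0 : N != 0.
  rewrite -(intr_eq0 algC) normE; apply/prodf_neq0 => i _.
  by rewrite no_root.
have: ((p ^ (2 * ord_mod k p) * totient k ^ totient k)%:R <=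
       ((k * s) ^ totient k)%:R :> algC); last by rewrite ler_nat leqNgt small.
apply: (@le_trans _ _ (`|N%:~R| ^+ 2 * (totient k)%:R ^+ totient k)).
  rewrite natrM !natrX ler_wpM2r ?exprn_ge0 ?ler0n // mulnC exprM.
  rewrite lerXn2r ?nnegrE ?exprn_ge0 ?ler0n ?normr_ge0 //.
  by rewrite -intr_norm -natrX -abszE -pmulrn ler_nat dvdn_leq // absz_gt0.
pose E (u : 'I_k) : algC := `|(map_poly intr f).[z ^+ u]| ^+ 2.
have -> : `|N%:~R| ^+ 2 = \prod_(u in A) E u.
  by rewrite normE normr_prod -prodrXl [RHS]big_enum_val.
rewrite -{2}cardA -prodr_const -big_split /=.
(* Means inequality over the primitive roots, then add the other k-th roots. *)
under eq_bigr do rewrite mulr_natr -cardA.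
apply: le_trans (leif_AGM_scaled _) _ => [u _|].
  by rewrite mulrn_wge0 // exprn_ge0.
rewrite cardA natrX lerXn2r ?nnegrE ?ler0n ?sumr_ge0 // => [u _|].
  by rewrite exprn_ge0.
apply: (@le_trans _ _ (\sum_(u < k) E u)).
  by rewrite [leRHS](bigID A) lerDl sumr_ge0 // => u _; rewrite exprn_ge0.
rewrite parseval_prim_root // natrM -[X in _ <= _ * X]/(s%:Z%:~R).
by rewrite -[X in _ <= X * _]/(k%:Z%:~R) -intrM ler_int ler_wpM2l.
Qed.

(** * Four-term relations between roots of unity *)

Lemma add_inv_inj (K : fieldType) (x x' : K) :
  x != 0 -> x' != 0 -> x + x^-1 = x' + x'^-1 -> x = x' \/ x * x' = 1.
Proof.
move=> x0 x'0 eq_xx'; have: (x - x') * (x * x' - 1) = 0.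
  have -> : (x - x') * (x * x' - 1) = x * x' * (x + x^-1) - x * x' * (x' + x'^-1).
    by field; rewrite x'0 x0.
  by rewrite eq_xx' subrr.
by move/eqP; rewrite mulf_eq0 !subr_eq0 => /orP[] /eqP; [left | right].
Qed.

(** On the unit circle [`|1 + x| ^+ 2 = 2 + (x + x^-1)], so taking moduli
    eliminates [y] and determines [x] up to inversion. *)
Lemma unit_norm_ratio (x y x' : algC) :
  `|x| = 1 -> `|y| = 1 -> `|x'| = 1 -> 1 + x = y * (1 + x') ->
  x = x' \/ x * x' = 1.
Proof.
move=> x1 y1 x'1 eq1; have n0 (t : algC) : `|t| = 1 -> t != 0.
  by move=> t1; rewrite -normr_eq0 t1 oner_eq0.
have sq (t : algC) : `|t| = 1 -> `|1 + t| ^+ 2 = 2 + (t + t^-1).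
  move=> t1; rewrite normCK rmorphD rmorph1 /= mulrDl mul1r mulrDr mulr1.
  by rewrite -normCK t1 invC_norm t1 expr1n invr1 mul1r; ring.
apply: add_inv_inj; rewrite ?n0 //; apply: (@addrI _ 2).
by rewrite -!sq // eq1 normrM y1 mul1r.
Qed.

(** The exponents of the two positive terms differ, as do those of the two
    negative ones, so every coefficient is [-1], [0] or [1] and is accounted for
    by the terms producing it; opposite terms may cancel, hence the inequality. *)
Lemma sum_sqr_four_term_coef (i j l k : nat) :
  i != 0%N -> j != l ->
  \sum_(m < k) ('X^0 + 'X^i - 'X^j - 'X^l : {poly int})`_m ^+ 2 <= 4.
Proof.
move=> i0 neq_jl; have sum_eq n : \sum_(m < k) (m == n :> nat)%:Z <= 1.
  have [lt_nk|le_kn] := ltnP n k.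
    rewrite (bigD1 (Ordinal lt_nk)) //= eqxx big1 // => m.
    by rewrite -val_eqE /= => /negPf->.
  by rewrite big1 // => m _; rewrite ltn_eqF // (leq_trans (ltn_ord m)).
apply: (@le_trans _ _ (\sum_(m < k) ((m == 0%N :> nat)%:Z + (m == i :> nat)%:Z
    + (m == j :> nat)%:Z + (m == l :> nat)%:Z))); last first.
  by rewrite !big_split /= (_ : 4 = 1 + 1 + 1 + 1) // !lerD.
apply: ler_sum => m _; rewrite !coefE.
have: ~~ ((m == j :> nat) && (m == l :> nat)).
  by apply: contra neq_jl => /andP[/eqP<- /eqP<-].
have: ~~ ((m == 0%N :> nat) && (m == i :> nat)).
  by apply: contra i0 => /andP[/eqP<- /eqP<-].
by do 4![case: eqP => _].
Qed.

(** The relation lifts to complex roots of unity, where [unit_norm_ratio]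
    applies; both conclusions are congruences between exponents mod [k], and
    these do not depend on the primitive root.  If [w ^+ i] or [w ^+ i'] were
    [1], two equal terms would double a coefficient and spoil the bound 4. *)
Lemma prim_root_ratio (F : fieldType) (p k : nat) (w : F) (i j i' : nat) :
  p \in [pchar F] -> (1 < k)%N -> coprime k p -> k.-primitive_root w ->
  ((k * 4) ^ totient k < p ^ (2 * ord_mod k p) * totient k ^ totient k)%N ->
  w ^+ i != 1 -> w ^+ i' != 1 -> 1 + w ^+ i = w ^+ j * (1 + w ^+ i') ->
  w ^+ i = w ^+ i' \/ w ^+ i * w ^+ i' = 1.
Proof.
move=> charFp k_gt1 co_kp w_prim small wi1 wi'1 eq_w.
have k_gt0 := ltnW k_gt1.
pose f : {poly int} := 'X^0 + 'X^(i %% k) - 'X^(j %% k) - 'X^((j + i') %% k).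
have fE (K : comNzRingType) (z : K) : k.-primitive_root z ->
    (map_poly intr f).[z] = 1 + z ^+ i - z ^+ j * (1 + z ^+ i').
  move=> z_prim; rewrite !rmorphB rmorphD /= !map_polyXn.
  rewrite !(hornerD, hornerN) !hornerXn !(prim_expr_mod z_prim) expr0.
  by rewrite mulrDr mulr1 exprD opprD addrA.
have szf : (size f <= k)%N.
  apply/leq_sizeP => m le_km; rewrite !coefE.
  by rewrite !gtn_eqF ?(leq_trans _ le_km) ?ltn_mod.
have exp_neq1 m : w ^+ m != 1 -> (m %% k != 0)%N.
  by apply: contra => m0; rewrite -(prim_order_dvd w_prim).
have [||z z_prim] := root_lift_of_small_norm charFp k_gt1 co_kp w_prim szf _ small.
- apply: sum_sqr_four_term_coef; first exact: exp_neq1.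
  apply: contra (exp_neq1 _ wi'1) => /eqP eq_j.
  by rewrite -(mod0n k) -(eqn_modDl j) addn0 eq_j.
- by rewrite fE // eq_w subrr.
rewrite fE // => /eqP; rewrite subr_eq0 => /eqP eq_z.
have nz m : `|z ^+ m| = 1.
  rewrite normrX; apply/eqP; rewrite -(@pexpr_eq1 _ _ k) ?exprn_ge0 //.
  by rewrite -exprM mulnC exprM -normrX (prim_expr_order z_prim) normr1 expr1n.
have [/eqP|/eqP] := unit_norm_ratio (nz i) (nz j) (nz i') eq_z.
  rewrite (eq_prim_root_expr z_prim) -(eq_prim_root_expr w_prim) => /eqP.
  by left.
rewrite -exprD -(prim_order_dvd z_prim) (prim_order_dvd w_prim) exprD => /eqP.
by right.
Qed.

(** The hypothesis on [p] raised to the power [2 * d], in integers. *)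
Lemma powR_bound_nat (R : realType) (p k t d : nat) :
  (0 < t)%N -> (0 < d)%N ->
  (4 * k%:R / t%:R) `^ (t%:R / (2 * d%:R)) < p%:R :> R ->
  ((k * 4) ^ t < p ^ (2 * d) * t ^ t)%N.
Proof.
move=> t_gt0 d_gt0; set B := _ / _; set r := _ / _.
have t0 : t%:R != 0 :> R by rewrite pnatr_eq0 -lt0n.
have B_ge0 : 0 <= B by rewrite divr_ge0 ?mulr_ge0 ?ler0n.
have d2_gt0 : (0 < 2 * d)%N by rewrite muln_gt0.
rewrite -(ltr_pXn2r d2_gt0) ?nnegrE ?powR_ge0 ?ler0n //.
rewrite -powR_mulrn ?powR_ge0 // -powRrM /r natrM divfK; last first.
  by rewrite -natrM pnatr_eq0 -lt0n.
rewrite powR_mulrn // -(ltr_pM2r (exprn_gt0 t (_ : 0 < t%:R))) ?ltr0n //.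
by rewrite -exprMn divfK // mulrC -(natrM _ k 4) -!natrX -natrM ltr_nat.
Qed.

(** * The bound on cyclotomic numbers *)

Theorem theorem5p3 (R : realType) (F : finFieldType) (p n q e k a : nat) (g : F)
    (p_prime : prime p) (q_def : q = (p ^ n)%N) (cardF : #|F| = q)
    (g_prim : (q - 1)%N.-primitive_root g)
    (e_dvd : nontrivial_divisor e (q - 1)) (k_dvd : nontrivial_divisor k (q - 1))
    (q_ek : q = (e * k + 1)%N)
    (a_range : (1 <= a <= e - 1)%N)
    (p_large : (4 * k%:R / (totient k)%:R)
                 `^ ((totient k)%:R / (2 * (ord_mod k p)%:R)) < p%:R :> R) :
  (cyc_number g e k 0 a%:Z <= if (1 + 1)%R \in cyc_class g e k a%:Z then 3 else 2)%N.
Proof.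
have q1_gt0 := prim_order_gt0 g_prim.
have q1E : (q - 1 = e * k)%N by rewrite q_ek addnK.
have [e_gt0 k_gt0] : (0 < e)%N /\ (0 < k)%N.
  by apply/andP; rewrite -muln_gt0 -q1E.
have k_gt1 : (1 < k)%N by rewrite ltn_neqAle eq_sym k_gt0 andbT; case/and3P: k_dvd.
have charFp : p \in [pchar F] by apply: (@card_finPcharP _ _ n); rewrite ?cardF.
have co_kp : coprime k p.
  rewrite coprime_sym prime_coprime //; apply/negP => p_k.
  have : (p %| q)%N.
    rewrite q_def -[p in (p %| _)%N]expn1 dvdn_exp2l // lt0n.
    by apply: contraTneq q1_gt0 => n0; rewrite q_def n0.
  by rewrite q_ek dvdn_addr ?dvdn_mull // dvdn1 => /eqP p1; rewrite p1 in p_prime.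
have phi_gt0 : (0 < totient k)%N by rewrite totient_gt0.
have small := powR_bound_nat phi_gt0 (ord_mod_gt0 k p) p_large.
pose w := g ^+ e; have w_prim : k.-primitive_root w.
  by have := dvdn_prim_root g_prim (_ : k %| _)%N; rewrite q1E mulnK // dvdn_mull //; apply.
have classE b x : x \in cyc_class g e k b%:Z -> exists i : nat, x = g ^+ b * w ^+ i.
  by case/imsetP=> i _ ->; exists i; rewrite -PoszD -exprnP exprD -exprM mulnC.
rewrite /cyc_number; set S := [set _ | _].
rewrite (cardsD1 (1, 1 + 1)); set D := S :\ _.
have SP xy : xy \in S -> exists i r, [/\ xy.1 = w ^+ i,
    xy.2 = 1 + w ^+ i & 1 + w ^+ i = g ^+ a * w ^+ r].
  rewrite inE => /and3P[/classE[i ->] /classE[r ->] /eqP].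
  by rewrite expr0 mul1r => eq_x; exists i, r; rewrite -eq_x.
(* D collects the solutions with x != 1; x = 1 is one only if 2 is in C_a. *)
suff D2 : (#|D| <= 2)%N.
  case: ifP => [_|nC]; first by rewrite (leq_add (leq_b1 _)).
  by rewrite inE /= nC andbF.
have [->|[xy0 Dxy0]] := set_0Vmem D; first by rewrite cards0.
have DP xy : xy \in D -> exists i r, [/\ xy = (w ^+ i, 1 + w ^+ i),
    w ^+ i != 1 & 1 + w ^+ i = g ^+ a * w ^+ r].
  rewrite in_setD1 => /andP[xy1 /SP[i [r [x1 x2 eq_r]]]]; exists i, r.
  split=> //; first by rewrite -x2 -x1 -surjective_pairing.
  by apply: contraNneq xy1 => wi1; rewrite [xy]surjective_pairing x1 x2 wi1.
have [i0 [r0 [_ wi01 eq_r0]]] := DP _ Dxy0.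
pose x0 := w ^+ i0.
pose D' : {set F * F} := [set (x0, 1 + x0); (x0^-1, 1 + x0^-1)].
have D'2 : (#|D'| <= 2)%N by rewrite cards2; case: eqP.
apply: leq_trans D'2; apply/subset_leq_card/subsetP => xy.
move=> /DP[i [r [-> wi1 eq_r]]]; rewrite !inE.
(* w ^+ (r0 * k.-1) is the inverse of w ^+ r0, so dividing 1 + w ^+ i by
   1 + w ^+ i0 leaves w ^+ r / w ^+ r0. *)
have wr0_inv : w ^+ r0 * w ^+ (r0 * k.-1) = 1.
  rewrite -exprD -mulnS prednK // mulnC exprM (prim_expr_order w_prim).
  exact: expr1n.
have eq_ratio : 1 + w ^+ i = w ^+ (r + r0 * k.-1) * (1 + w ^+ i0).
  rewrite eq_r eq_r0 exprD [RHS]mulrCA -mulrA [w ^+ (r0 * _) * _]mulrC.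
  by rewrite wr0_inv mulr1.
have [->|] := prim_root_ratio charFp k_gt1 co_kp w_prim small wi1 wi01 eq_ratio.
  by rewrite eqxx.
by move/mulr1_eq=> inv_wi; rewrite /x0 -inv_wi invrK eqxx orbT.
Qed.
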